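(* Let $p>5$ be a prime. Then $$\sum_{k=1}^{p-1}\frac{2^kH_k}{k}\equiv -q_p(2)^2\pmod{p}.$$
   Context: $H_n=\sum_{k=1}^n\frac1k$ is the $n$th harmonic number. For an odd prime $p$, $q_p(2)=\frac{2^{p-1}-1}{p}$ is the Fermat quotient of $2$ to base $p$. The congruence is between rational numbers whose denominators are prime to $p$: $a\equiv b\pmod{p}$ means that $a-b$ is $p$ times a rational number with denominator prime to $p$. *)

(* Defs.v *)
From mathcomp Require Import all_boot all_order all_algebra.

Set Implicit Arguments.
Unset Strict Implicit.
Unset Printing Implicit Defensive.

Import Order.TTheory GRing.Theory Num.Theory.
Local Open Scope ring_scope.

Definition harmonic (n : nat) : rat := \sum_(1 <= k < n.+1) k%:R^-1.

Definition fermat_quotient (p a : nat) : rat := (a%:R ^+ p.-1 - 1) / p%:R.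

Definition p_integral (p : nat) (x : rat) : bool := coprimez p (denq x).

(* Meant for p-integral a and b; if either of them is p-integral, the relation
   forces the other to be so as well. *)
Definition rat_congr (p : nat) (a b : rat) : Prop :=
  exists2 c : rat, p_integral p c & a - b = p%:R * c.

(* Main.v *)
Require Import Defs.
From mathcomp Require Import all_boot all_order all_algebra.
From mathcomp Require Import zify ring.

Import Order.TTheory GRing.Theory Num.Theory.
Local Open Scope ring_scope.

(** Write [L_s(x) = \sum_(0 < k < p) x^k / k^s] and
    [W(x) = \sum_(0 < j < k < p) x^k / (j k)] in characteristic [p].
    Since ['C(p-1, k) = (-1)^k], the binomial transform identities for
    [(-x)^k / k^2] give [L_2(x) = W(1) - W(1 - x)], and [W(1) = L_2(1) = 0]
    because [2 W(1) + L_2(1) = L_1(1)^2 = 0] and [p <> 3].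
    The substitution [k -> p - k] gives [L_2(-1) = 0], hence [W(2) = 0], so that
    the sum is [W(2) + L_2(2) = L_2(2) = - W(-1)].  Expanding [L_1(-1)^2] and
    splitting the pairs [(a, b)] according to the sign of [a + b - p] gives
    [L_1(-1)^2 = 4 W(-1)].  Finally [L_1(-1) = - 2 q_p(2)], by expanding
    [2^p = (1 + 1)^p]. *)

Definition polylog (F : fieldType) (n s : nat) (x : F) : F :=
  \sum_(1 <= k < n) x ^+ k / k%:R ^+ s.

Definition double_polylog (F : fieldType) (n : nat) (x : F) : F :=
  \sum_(1 <= k < n) x ^+ k * (\sum_(1 <= j < k) j%:R^-1) / k%:R.

Arguments polylog {F}.
Arguments double_polylog {F}.

(** * Binomial sums and rearrangements of double sums *)

Section BinomialTransform.

Variables (F : fieldType) (n : nat).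
Hypothesis nat_neq0 : forall k, (0 < k <= n)%N -> k%:R != 0 :> F.

(** Induction on the row index, with the bound in [nat_neq0] kept at [n]. Pascal's rule splits row m
    + 1, and C(m, k-1) / k = C(m+1, k) / (m+1) turns the extra part into the new summand on the
    right. *)
Lemma sum_bin_div (f : nat -> F) :
  \sum_(1 <= k < n.+1) 'C(n, k)%:R * (f k / k%:R)
  = \sum_(1 <= m < n.+1) (\sum_(1 <= k < m.+1) 'C(m, k)%:R * f k) / m%:R.
Proof.
elim: {-2}n (leqnn n) => [|m IHm] lt_mn; first by rewrite !big_geq.
rewrite [RHS]big_nat_recr //= -IHm 1?ltnW // mulr_suml.
have -> : \sum_(1 <= k < m.+1) 'C(m, k)%:R * (f k / k%:R)
        = \sum_(1 <= k < m.+2) 'C(m, k)%:R * (f k / k%:R).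
  by rewrite [RHS]big_nat_recr //= bin_small // mul0r addr0.
rewrite -big_split /=; apply: eq_big_nat => -[//|k] /= lt_km.
have k0 : k.+1%:R != 0 :> F by apply: nat_neq0; lia.
have m0 : m.+1%:R != 0 :> F by apply: nat_neq0; lia.
have /(congr1 (fun i : nat => i%:R : F)) := mul_bin_diag m.+1 k.
rewrite /= !natrM => diag.
have -> : 'C(m.+1, k.+1)%:R * f k.+1 / m.+1%:R
        = 'C(m, k)%:R * (f k.+1 / k.+1%:R).
  have -> : 'C(m, k)%:R = k.+1%:R * 'C(m.+1, k.+1)%:R / m.+1%:R :> F.
    by rewrite -diag mulrC mulKf.
  by move: k0 m0; move: k.+1%:R m.+1%:R => K M k0 m0; field; rewrite k0 m0.
by rewrite binS natrD mulrDl.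
Qed.

End BinomialTransform.

Lemma sum_bin_exp (F : fieldType) (m : nat) (x : F) :
  \sum_(1 <= k < m.+1) 'C(m, k)%:R * (- x) ^+ k = (1 - x) ^+ m - 1.
Proof.
rewrite exprDn -(big_mkord xpredT (fun i => 1 ^+ (m - i) * (- x) ^+ i *+ 'C(m, i))).
rewrite big_nat_recl // big_add1 /= bin0 expr0 expr1n mulr1 mulr1n addrC addKr.
by apply: eq_bigr => k _; rewrite expr1n mul1r mulr_natl.
Qed.

(** Each of the two factors 1/k is absorbed by one use of [sum_bin_div]; the binomial theorem
    evaluates what remains. *)
Lemma sum_bin_polylog2 (F : fieldType) (n : nat) (x : F) :
  (forall k, (0 < k <= n)%N -> k%:R != 0 :> F) ->
  \sum_(1 <= k < n.+1) 'C(n, k)%:R * ((- x) ^+ k / k%:R ^+ 2)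
  = \sum_(1 <= m < n.+1)
      (\sum_(1 <= j < m.+1) ((1 - x) ^+ j - 1) / j%:R) / m%:R.
Proof.
move=> n0.
under eq_bigr do rewrite expr2 invfM [_ ^+ _ * _]mulrA.
rewrite sum_bin_div //; apply: eq_big_nat => m /andP[_ lt_mn]; congr (_ / _).
rewrite sum_bin_div; last by move=> k lekm; apply: n0; lia.
by apply: eq_bigr => j _; rewrite sum_bin_exp.
Qed.

(** As p divides C(p, k+1), Pascal's rule makes neighbours in row p - 1 opposite. *)
Lemma bin_pred_prime (F : fieldType) (p k : nat) :
  p \in [pchar F] -> (k < p)%N -> 'C(p.-1, k)%:R = (-1) ^+ k :> F.
Proof.
move=> charFp; have p_pr := pcharf_prime charFp.
elim: k => [|k IHk] lt_kp; first by rewrite bin0.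
have : 'C(p, k.+1)%:R = 0 :> F.
  by apply/eqP; rewrite -(dvdn_pcharf charFp) prime_dvd_bin.
rewrite -{1}(prednK (prime_gt0 p_pr)) binS natrD IHk 1?ltnW //.
by rewrite exprS mulN1r => /eqP; rewrite addr_eq0 => /eqP.
Qed.

(** Slices the triangle a + b < n along the antidiagonals a + b = m. *)
Lemma sum_bisection (R : nmodType) (n : nat) (g : nat -> nat -> R) :
  \sum_(1 <= a < n) \sum_(1 <= b < n - a) g a b
  = \sum_(1 <= m < n) \sum_(1 <= a < m) g a (m - a)%N.
Proof.
elim: n => [|[|n] IHn]; [by rewrite !big_geq..|].
rewrite [RHS]big_nat_recr //= -IHn [LHS]big_nat_recr //=.
rewrite [X in _ + X]big_geq ?addr0; last by lia.
rewrite -big_split /=; apply: eq_big_nat => a lt_an.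
by rewrite subSn ?big_nat_recr //=; lia.
Qed.

(** The pairs with j <= m are the full square minus those with m < j. *)
Lemma sum_by_parts (R : comPzRingType) (n : nat) (a b : nat -> R) :
  \sum_(1 <= m < n) (\sum_(1 <= j < m.+1) a j) * b m
  = (\sum_(1 <= j < n) a j) * (\sum_(1 <= i < n) b i)
    - \sum_(1 <= j < n) a j * \sum_(1 <= i < j) b i.
Proof.
elim: n => [|[|n] IHn]; [by rewrite !big_geq // mul0r subr0..|].
rewrite [LHS]big_nat_recr //= IHn.
by rewrite !(big_nat_recr n.+1) //=; ring.
Qed.

Lemma natr_pchar_neq0 (F : fieldType) (p k : nat) :
  p \in [pchar F] -> (0 < k < p)%N -> k%:R != 0 :> F.
Proof. by move=> charFp lekp; rewrite -(dvdn_pcharf charFp) gtnNdvd; lia. Qed.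

(** * Polylogarithm sums in characteristic p *)

Section PrimeCharacteristic.

Variables (F : fieldType) (p : nat).
Hypotheses (charFp : p \in [pchar F]) (p_gt3 : (3 < p)%N).

Let natF_neq0 k : (0 < k < p)%N -> k%:R != 0 :> F.
Proof. exact: natr_pchar_neq0. Qed.

Let natF_subp k : (k <= p)%N -> (p - k)%:R = - k%:R :> F.
Proof. by move=> le_kp; rewrite natrB // (pcharf0 charFp) sub0r. Qed.

Let exprN1_subp k : (k <= p)%N -> (-1) ^+ (p - k) = - (-1) ^+ k :> F.
Proof.
have p_pr := pcharf_prime charFp.
have odd_p : odd p by case: (even_prime p_pr) => // p2; move: p_gt3; rewrite p2.
move=> le_kp; rewrite -[LHS]signr_odd -[(-1) ^+ k]signr_odd oddB // odd_p addTb.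
by case: (odd k); rewrite /= ?opprK.
Qed.

(** The substitution k -> p - k shows that the sum is its own opposite. *)
Lemma sum_inv_pchar : \sum_(1 <= k < p) k%:R^-1 = 0 :> F.
Proof.
have /eqP : \sum_(1 <= k < p) k%:R^-1 = - \sum_(1 <= k < p) k%:R^-1 :> F.
  rewrite {1}big_nat_rev -sumrN; apply: eq_big_nat => k /andP[_ lt_kp].
  by rewrite add1n subSS natF_subp 1?ltnW // invrN.
rewrite -subr_eq0 opprK -mulr2n -mulr_natl mulf_eq0.
by rewrite (negPf (natF_neq0 2 _)) => [/eqP|]; last lia.
Qed.

Lemma double_polylog_reflection (x : F) :
  polylog p 2 x = double_polylog p 1 - double_polylog p (1 - x).
Proof.
have p_gt0 : (0 < p)%N by lia.
transitivity (\sum_(1 <= k < p) 'C(p.-1, k)%:R * ((- x) ^+ k / k%:R ^+ 2)).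
  apply: eq_big_nat => k /andP[_ lt_kp]; rewrite (bin_pred_prime _ p) //.
  by rewrite mulrA -exprMn mulN1r opprK.
rewrite -{1}(prednK p_gt0) sum_bin_polylog2 ?prednK //; last first.
  by move=> k lekp; apply: natF_neq0; lia.
(* The full-square term vanishes with the sum of inverses, so the sum over j <= m becomes minus a
   strict one, which is a difference of two values of W. *)
rewrite sum_by_parts sum_inv_pchar mulr0 sub0r -sumrN -sumrB.
by apply: eq_bigr => j _; rewrite expr1n; ring.
Qed.

Lemma polylog2_1E : polylog p 2 1 = double_polylog p 1 :> F.
Proof.
rewrite double_polylog_reflection subrr [X in _ - X]big_nat big1 ?subr0 // => k.
by case: k => // k _; rewrite expr0n !mul0r.
Qed.

(** The sum of 1 / (j m) over j <= m is - W(1) by parts, and L_2(1) + W(1) after splitting off the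
    diagonal. Since W(1) = L_2(1), this gives 3 L_2(1) = 0. *)
Lemma polylog2_1 : polylog p 2 1 = 0 :> F.
Proof.
have : \sum_(1 <= m < p) (\sum_(1 <= j < m.+1) j%:R^-1) * m%:R^-1
     = \sum_(1 <= m < p) m%:R^-1 / m%:R
       + \sum_(1 <= m < p) (\sum_(1 <= j < m) j%:R^-1) * m%:R^-1 :> F.
  rewrite -big_split; apply: eq_big_nat => -[//|m] _.
  by rewrite (big_nat_recr m.+1) //= mulrDl addrC.
rewrite sum_by_parts sum_inv_pchar mulr0 sub0r.
have -> : \sum_(1 <= m < p) (\sum_(1 <= j < m) j%:R^-1) * m%:R^-1
        = double_polylog p 1 :> F.
  by apply: eq_bigr => k _; rewrite expr1n mul1r.
have -> : \sum_(1 <= j < p) j%:R^-1 * \sum_(1 <= i < j) i%:R^-1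
        = double_polylog p 1 :> F.
  by apply: eq_bigr => k _; rewrite expr1n mul1r mulrC.
have -> : \sum_(1 <= m < p) m%:R^-1 / m%:R = polylog p 2 1 :> F.
  by apply: eq_bigr => k _; rewrite expr1n mul1r -invfM.
rewrite -polylog2_1E => eqG.
have /eqP : 3 * polylog p 2 1 = 0 :> F.
  by rewrite [LHS](_ : _ = polylog p 2 1 + polylog p 2 1 - - polylog p 2 1);
    [rewrite -eqG subrr | ring].
by rewrite mulf_eq0 (negPf (natF_neq0 3 _)) => [/eqP|]; last lia.
Qed.

Lemma polylog2_N1 : polylog p 2 (-1) = 0 :> F.
Proof.
have /eqP : polylog p 2 (-1) = - polylog p 2 (-1) :> F.
  rewrite {1}/polylog big_nat_rev -sumrN; apply: eq_big_nat => k /andP[_ lt_kp].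
  by rewrite add1n subSS natF_subp ?exprN1_subp 1?ltnW // sqrrN mulNr.
rewrite -subr_eq0 opprK -mulr2n -mulr_natl mulf_eq0.
by rewrite (negPf (natF_neq0 2 _)) => [/eqP|]; last lia.
Qed.

Lemma polylog1_N1_sqr : polylog p 1 (-1) ^+ 2 = 4 * double_polylog p (-1) :> F.
Proof.
pose g a b : F := (-1) ^+ a / a%:R * ((-1) ^+ b / b%:R).
(* [1 / (a (m - a)) = (1 / a + 1 / (m - a)) / m] *)
have low : \sum_(1 <= a < p) \sum_(1 <= b < p - a) g a b = 2 * double_polylog p (-1).
  rewrite sum_bisection mulr_sumr; apply: eq_big_nat => m /andP[m_gt0 lt_mp].
  have -> : \sum_(1 <= a < m) g a (m - a)%N
          = \sum_(1 <= a < m) (-1) ^+ m / m%:R * (a%:R^-1 + (m - a)%:R^-1).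
    apply: eq_big_nat => a /andP[a_gt0 lt_am]; rewrite /g.
    have a0 : a%:R != 0 :> F by apply: natF_neq0; lia.
    have b0 : (m - a)%:R != 0 :> F by apply: natF_neq0; lia.
    have m0 : m%:R != 0 :> F by apply: natF_neq0; lia.
    have mE : m%:R = a%:R + (m - a)%:R :> F by rewrite -natrD subnKC // ltnW.
    have -> : (-1) ^+ m = (-1) ^+ a * (-1) ^+ (m - a) :> F.
      by rewrite -exprD subnKC // ltnW.
    rewrite mE in m0 *.
    move: a%:R (m - a)%:R ((-1) ^+ a) ((-1) ^+ (m - a)) a0 b0 m0 => u v s t u0 v0 uv0.
    by field; rewrite u0 v0 uv0.
  rewrite -mulr_sumr big_split /= [X in _ + X]big_nat_rev /=.
  have -> : \sum_(1 <= a < m) (m - (1 + m - a.+1))%:R^-1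
          = \sum_(1 <= a < m) a%:R^-1 :> F.
    by apply: eq_big_nat => a lt_am; congr (_%:R^-1); lia.
  ring.
(* On a + b = p the two minus signs, from the power and from the denominator, cancel, leaving 1 /
   a^2. *)
have diag : \sum_(1 <= a < p) g a (p - a)%N = 0.
  transitivity (polylog p 2 1 : F); last exact: polylog2_1.
  apply: eq_big_nat => a /andP[a_gt0 lt_ap].
  rewrite /g natF_subp ?exprN1_subp 1?ltnW // expr1n.
  by rewrite invrN mulrNN mulrACA -invfM -!expr2 sqrr_sign.
(* The map (a, b) -> (p - a, p - b) exchanges a + b > p with a + b < p and preserves each factor
   (-1)^a / a. *)
have high : \sum_(1 <= a < p) \sum_((p - a).+1 <= b < p) g a b
          = \sum_(1 <= a < p) \sum_(1 <= b < p - a) g a b.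
  rewrite big_nat_rev; apply: eq_big_nat => a lt_ap.
  rewrite add1n subSS subKn; last by lia.
  rewrite [LHS]big_nat_rev -[X in index_iota X]add1n big_addn.
  apply: eq_big_nat => b lt_b; rewrite /g.
  have -> : (1 + a + p - (b + a).+1 = p - b)%N by lia.
  by rewrite !natF_subp ?exprN1_subp ?invrN ?mulrNN //; lia.
transitivity (\sum_(1 <= a < p) (\sum_(1 <= b < p - a) g a b
                + (g a (p - a)%N + \sum_((p - a).+1 <= b < p) g a b))).
  rewrite expr2 /polylog big_distrlr /=; apply: eq_big_nat => a lt_ap.
  rewrite (big_cat_nat (n := p - a)) /=; [|lia|lia].
  by rewrite (big_ltn (m := p - a)); last lia.
rewrite !big_split /= high diag low; ring.
Qed.

Lemma sum_pow2_harmonic :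
  \sum_(1 <= k < p) 2 ^+ k * (\sum_(1 <= j < k.+1) j%:R^-1) / k%:R
  = - (polylog p 1 (-1) / 2) ^+ 2 :> F.
Proof.
(* At -1 the reflection gives W(2) = W(1); at 2 it gives L_2(2) = W(1) - W(-1). *)
have G2 := double_polylog_reflection 2; have GN1 := double_polylog_reflection (-1).
rewrite polylog2_N1 opprK -[1 + 1]/(2%:R) in GN1.
have N1 : 1 - 2 = -1 :> F by ring.
have two_neq0 : 2 != 0 :> F by apply: natF_neq0; lia.
transitivity (double_polylog p 2 + polylog p 2 2 : F).
  rewrite -big_split; apply: eq_big_nat => -[//|k] _.
  rewrite (big_nat_recr k.+1) //= mulrDr mulrDl expr2 invfM.
  by rewrite [_ * (_ * _)]mulrA.
rewrite G2 N1 expr_div_n polylog1_N1_sqr.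
rewrite -polylog2_1E polylog2_1 in GN1 *.
move/eqP: GN1; rewrite eq_sym subr_eq0 => /eqP <-.
by field; rewrite (natrM _ 2 2) mulf_neq0.
Qed.

End PrimeCharacteristic.

(** * Reduction of rationals modulo p, and the Fermat quotient *)

Section Reduction.

Variables (F : fieldType) (p : nat).
Hypothesis charFp : p \in [pchar F].

(* [x] is [p]-integral with residue [a]; the fraction [u / v] need not be in
   lowest terms, which makes closure under the ring operations immediate. *)
Definition reduces_to (x : rat) (a : F) : Prop :=
  exists u v : int,
    [/\ v%:~R != 0 :> F, x * v%:~R = u%:~R & a * v%:~R = u%:~R].

Lemma reduces_int (u : int) : reduces_to u%:~R u%:~R.
Proof. by exists u, 1; rewrite !mulr1 oner_neq0. Qed.

Lemma reduces_nat (n : nat) : reduces_to n%:R n%:R.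
Proof. exact: reduces_int n. Qed.

Lemma reduces_add x y a b :
  reduces_to x a -> reduces_to y b -> reduces_to (x + y) (a + b).
Proof.
move=> [u [v [v0 xv av]]] [w [z [z0 yz bz]]]; exists (u * z + w * v), (v * z).
rewrite !intrD !intrM mulf_neq0 // -xv -yz -av -bz; split=> //; ring.
Qed.

Lemma reduces_mul x y a b :
  reduces_to x a -> reduces_to y b -> reduces_to (x * y) (a * b).
Proof.
move=> [u [v [v0 xv av]]] [w [z [z0 yz bz]]]; exists (u * w), (v * z).
by rewrite !intrM mulf_neq0 // -xv -yz -av -bz; split=> //; ring.
Qed.

Lemma reduces_opp x a : reduces_to x a -> reduces_to (- x) (- a).
Proof.
by rewrite -mulN1r -[- a]mulN1r; apply: reduces_mul; apply: reduces_int (-1).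
Qed.

Lemma reduces_exp x a n : reduces_to x a -> reduces_to (x ^+ n) (a ^+ n).
Proof.
move=> xa; elim: n => [|n IHn]; first exact: reduces_nat 1.
by rewrite !exprS; apply: reduces_mul.
Qed.

Lemma reduces_natV (n : nat) : n%:R != 0 :> F -> reduces_to n%:R^-1 n%:R^-1.
Proof.
move=> n0; have n0Q : n%:R != 0 :> rat.
  by rewrite pnatr_eq0; apply: contraNneq n0 => ->.
by exists 1, n; rewrite -!pmulrn !mulVf.
Qed.

Lemma reduces_sum (m n : nat) (f : nat -> rat) (g : nat -> F) :
  (forall k, (m <= k < n)%N -> reduces_to (f k) (g k)) ->
  reduces_to (\sum_(m <= k < n) f k) (\sum_(m <= k < n) g k).
Proof.
move=> fg; rewrite big_nat [X in reduces_to _ X]big_nat.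
apply: (big_rec2 reduces_to) => [|k y x /fg fgk]; first exact: reduces_nat 0.
exact: reduces_add.
Qed.

Lemma reduces0_rat_congr x y : reduces_to (x - y) 0 -> rat_congr p x y.
Proof.
have p_pr := pcharf_prime charFp.
move=> [u [v [v0 xv]]]; rewrite mul0r => /esym/eqP.
rewrite -(dvdz_pcharf charFp) => /dvdzP[w uE].
have vQ0 : v%:~R != 0 :> rat.
  by rewrite intr_eq0; apply: contraNneq v0 => ->.
exists (w%:~R / v%:~R); last first.
  by apply: (mulIf vQ0); rewrite xv uE intrM -pmulrn mulrA divfK // mulrC.
(* The fraction w / v may be reducible, but Gauss's lemma shows that the denominator of [c] divides
   v, which is prime to p. *)
set c := _ / _.
have /eqP : (numq c * v)%:~R = (w * denq c)%:~R :> rat.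
  by rewrite !intrM numqE mulrAC /c divfK.
rewrite eqr_int => /eqP eq_nd.
have dvd_cv : (denq c %| v)%Z.
  rewrite -(@Gauss_dvdzr _ (numq c)) ?eq_nd ?dvdz_mull //.
  by rewrite coprimez_sym; apply: coprime_num_den.
rewrite -(dvdz_pcharf charFp) dvdzE -prime_coprime // in v0.
exact: coprime_dvdr dvd_cv v0.
Qed.

End Reduction.

(** The division by p is carried out over the rationals before reducing: C(p, k) / p = C(p-1, k-1) /
    k turns (2^p - 2) / p into a sum with denominators prime to p, and then C(p-1, k-1) becomes
    (-1)^(k-1). *)
Lemma reduces_fermat_quotient2 (F : fieldType) (p : nat) :
  p \in [pchar F] -> (2 < p)%N ->
  reduces_to F (fermat_quotient p 2) (- (polylog p 1 (-1) / 2)).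
Proof.
move=> charFp p_gt2; have p_pr := pcharf_prime charFp.
have p0 : p%:R != 0 :> rat by rewrite pnatr_eq0 -lt0n prime_gt0.
have k0 k : (0 < k < p)%N -> k%:R != 0 :> F by apply: natr_pchar_neq0.
have -> : fermat_quotient p 2 = (\sum_(1 <= k < p) 'C(p.-1, k.-1)%:R / k%:R) / 2.
  have -> : \sum_(1 <= k < p) 'C(p.-1, k.-1)%:R / k%:R
          = (\sum_(1 <= k < p) 'C(p, k)%:R * (- -1) ^+ k) / p%:R :> rat.
    rewrite mulr_suml; apply: eq_big_nat => -[//|k] _.
    have kQ0 : k.+1%:R != 0 :> rat by rewrite pnatr_eq0.
    have /(congr1 (fun i : nat => i%:R : rat)) := mul_bin_diag p k.
    rewrite !natrM opprK expr1n mulr1 => diag.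
    by apply/eqP; rewrite eqr_div // mulrC diag mulrC.
  have := sum_bin_exp rat p (-1); rewrite big_nat_recr ?prime_gt0 //=.
  rewrite binn !opprK expr1n mulr1 -[1 + 1]/(2%:R) => /(canRL (addrK _)) ->.
  have -> : 2 ^+ p = 2 * 2 ^+ p.-1 :> rat by rewrite -exprS prednK ?prime_gt0.
  by rewrite /fermat_quotient; field.
rewrite /polylog -mulNr -sumrN.
apply: reduces_mul; last by apply: reduces_natV; apply: k0.
apply: reduces_sum => -[//|k] lt_kp.
rewrite expr1 exprS mulN1r mulNr opprK -(bin_pred_prime _ p) //; last by lia.
by apply: reduces_mul; [apply: reduces_nat | apply: reduces_natV; apply: k0].
Qed.

Theorem corollary1p3 (p : nat) (p_prime : prime p) (p_gt5 : (5 < p)%N) :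
  rat_congr p (\sum_(1 <= k < p) 2 ^+ k * harmonic k / k%:R)
              (- fermat_quotient p 2 ^+ 2).
Proof.
have charFp : p \in [pchar 'F_p] by apply: pchar_Fp.
have k0 k : (0 < k < p)%N -> k%:R != 0 :> 'F_p by apply: natr_pchar_neq0.
apply: (reduces0_rat_congr _ _ charFp).
(* The residue 0 is written as a difference of equal terms, so that both sides of the congruence can
   be reduced separately to this common value. *)
have <- := subrr (- (polylog p 1 (-1) / 2) ^+ 2 : 'F_p).
apply: reduces_add; last first.
  apply/reduces_opp/reduces_opp; rewrite -[X in reduces_to _ _ X]sqrrN.
  by apply/reduces_exp/reduces_fermat_quotient2 => //; lia.
rewrite -sum_pow2_harmonic //; last by lia.
apply: reduces_sum => k lt_kp; apply: reduces_mul; last by apply/reduces_natV/k0.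
apply: reduces_mul; first exact/reduces_exp/reduces_nat.
by apply: reduces_sum => j lt_jk; apply/reduces_natV/k0; lia.
Qed.
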